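(* Let $n,N\ge1$, let $g_2,\dots,g_N\in\mathbb{R}^{n\times n}$, and set $g_1:=0$ and $g_{N+1}:=0$ (the zero $n\times n$ matrix). Let $g\in\mathbb{R}^{nN\times nN}$ be the block lower bidiagonal matrix with identity diagonal blocks and with $g_k$ in block position $(k,k-1)$ for $k=2,\dots,N$ (all other blocks zero). Then $$\max\Big(0,\ \min_{1\le k\le N}\big\{1+\sigma_{\min}^2(g_{k+1})-\sigma_{\max}(g_k)-\sigma_{\max}(g_{k+1})\big\}\Big)\le \sigma_{\min}^2(g)\le\sigma_{\max}^2(g)\le \max_{1\le k\le N}\big\{1+\sigma_{\max}^2(g_{k+1})+\sigma_{\max}(g_k)+\sigma_{\max}(g_{k+1})\big\}.$$
   Context: $\sigma_{\min},\sigma_{\max}$ denote the minimum and maximum singular values of a matrix (both are $0$ for the zero matrix). *)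

(* Defs.v *)
From HB Require Import structures.
From mathcomp Require Import all_boot all_order all_algebra.
From mathcomp Require Import boolp classical_sets reals.
Set Implicit Arguments.
Unset Strict Implicit.
Unset Printing Implicit Defensive.
Import Order.TTheory GRing.Theory Num.Theory.
Local Open Scope classical_set_scope.
Local Open Scope ring_scope.

(* Square roots of the eigenvalues of A^T A. *)
Definition singular_values (R : realType) (n : nat) (A : 'M[R]_n) : set R :=
  [set Num.sqrt a | a in [set a : R | eigenvalue (A^T *m A) a]].

(* For n >= 1 the set of singular values is finite and nonempty, so that [inf]
   and [sup] are its minimum and maximum.  The case n = 0 is degenerate. *)
Definition sigma_min (R : realType) (n : nat) (A : 'M[R]_n) : R :=
  inf (singular_values A).

Definition sigma_max (R : realType) (n : nat) (A : 'M[R]_n) : R :=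
  sup (singular_values A).

(* The blocks g k are indexed from 1 whereas the ordinals i and j are indexed
   from 0: block position (k, k - 1) is (i, j) with i = k - 1 and j = k - 2, and
   it contains g k = g i.+1. *)
Definition bidiag_mx (R : realType) (n N : nat) (g : nat -> 'M[R]_n) :
    'M[R]_(\sum_(i < N) n) :=
  \mxblock_(i < N, j < N)
    (if i == j then 1%:M
     else if i == j.+1 :> nat then g i.+1
     else 0 : 'M[R]_n).

(* Minimum and maximum of F 1, ..., F N for N >= 1; the default value of the
   iterated operator is the member F 1, hence it does not affect the result. *)
Definition min_upto (R : realType) (N : nat) (F : nat -> R) : R :=
  \big[Num.min/F 1%N]_(1 <= k < N.+1) F k.

Definition max_upto (R : realType) (N : nat) (F : nat -> R) : R :=
  \big[Num.max/F 1%N]_(1 <= k < N.+1) F k.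

(* Main.v *)
Require Import Defs.
From HB Require Import structures.
From mathcomp Require Import all_boot all_order all_algebra.
From mathcomp Require Import boolp classical_sets reals.
From mathcomp.real_closed Require complex.
From mathcomp Require Import ring lra.
Set Implicit Arguments.
Unset Strict Implicit.
Unset Printing Implicit Defensive.
Import Order.TTheory GRing.Theory Num.Theory.
Local Open Scope ring_scope.

(** The extreme squared singular values of a nonempty square matrix [A] are the
    best constants in [sigma_min A ^+ 2 * |x|^2 <= |x A^T|^2 <= sigma_max A ^+ 2
    * |x|^2]: the bounds hold by [sigma_min_sqnorm] and [sigma_max_sqnorm], and
    by [sigma_bounds] they are at least as sharp as any other such bounds with a
    nonnegative lower constant.  The two bounds rest on the spectral theorem for
    the Gram matrix [A^T *m A], used in the form that its quadratic form is a sum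
    of eigenvalues weighted by nonnegative numbers of total [|x|^2]
    ([symmetric_spectral]).

    It remains to bound [|x g^T|^2] for the block bidiagonal matrix [g].  If
    [x_1, ..., x_N] are the blocks of [x] and [x_0 = 0], then block [k] of
    [x g^T] is [x_k + x_(k-1) g_k^T] ([bidiag_block]).  Its squared norm differs
    from [|x_k|^2 + |x_(k-1) g_k^T|^2] by a cross term of size at most
    [sigma_max g_k * (|x_k|^2 + |x_(k-1)|^2)] ([sqnormD_dist]), and
    [|x_(k-1) g_k^T|^2] lies between [sigma_min g_k ^+ 2 * |x_(k-1)|^2] and
    [sigma_max g_k ^+ 2 * |x_(k-1)|^2].  Summing over [k] and collecting the
    coefficient of each [|x_k|^2] ([sum_blocks_shift]) gives exactly the
    quantities whose minimum and maximum appear in the theorem; the condition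
    [g_(N+1) = 0] makes the collected coefficient right for the last block. *)

(** * Spectral decomposition of real quadratic forms *)

Definition sqnorm (R : pzRingType) (n : nat) (x : 'rV[R]_n) : R :=
  \sum_j x 0 j ^+ 2.

Lemma sqnormE (R : comPzRingType) n (x : 'rV[R]_n) : sqnorm x = (x *m x^T) 0 0.
Proof. by rewrite mxE; apply: eq_bigr => j _; rewrite mxE expr2. Qed.

Section Spectral.
Import complex.

(** The quadratic form of a symmetric matrix is a sum of eigenvalues weighted by
    the squared moduli of the coordinates of [x] in an orthonormal eigenbasis.
    Diagonalisation is done by a unitary matrix over [R[i]]; this suffices
    because the eigenvalues are real, hence roots of the characteristic
    polynomial over [R], and the moduli are real as well. *)
Lemma symmetric_spectral (R : rcfType) n (S : 'M[R]_n) : S^T = S ->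
  exists d : 'I_n -> R, (forall i, eigenvalue S (d i)) /\
    forall x : 'rV[R]_n, exists w : 'I_n -> R,
      [/\ forall i, 0 <= w i, sqnorm x = \sum_i w i
        & (x *m S *m x^T) 0 0 = \sum_i d i * w i].
Proof.
move=> symS; pose C := R[i].
pose f : {rmorphism R -> C} := real_complex R.
have f_inj : injective f := @complexI R.
pose A : 'M[C]_n := map_mx f S.
have embreal (r : R) : f r \is Num.real.
  by apply/CrealP/conjc_real.
have Areal : A \is a mxOver Num.real.
  by apply/mxOverP => i j; rewrite mxE.
have Aherm : A \is hermsymmx.
  apply: realsym_hermsym => //.
  apply/is_hermitianmxP; rewrite expr0 scale1r.
  by apply/matrixP => i j; rewrite !mxE -{1}symS mxE.
have /orthomx_spectralP := hermitian_normalmx Aherm.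
have := hermitian_spectral_diag_real Aherm.
have := spectral_unitarymx A.
move: (spectralmx A) (spectral_diag A) => P D Punit Dreal AE.
have dE i : D 0 i = f (Re (D 0 i)).
  by have /mxOverP/(_ 0 i)/RRe_real := Dreal.
exists (fun i => Re (D 0 i)); split => [i|x].
  rewrite eigenvalue_root_char -(fmorph_root f).
  rewrite map_char_poly -eigenvalue_root_char -/A -dE.
  (* Since [P *m A = diag_mx D *m P], row [i] of [P] is an eigenvector. *)
  apply/eigenvalueP; exists (row i P); last first.
    apply/eqP => rowP0; have := unitarymx_unit Punit.
    rewrite -row_free_unit => /row_freeP [Q PQ].
    have /rowP/(_ i) : row i (P *m Q) = 0 by rewrite row_mul rowP0 mul0mx.
    by rewrite PQ !mxE eqxx => /eqP; rewrite oner_eq0.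
  rewrite -row_mul -/A AE !mulmxA mulmxV ?unitarymx_unit // mul1mx.
  by rewrite row_mul row_diag_mx -scalemxAl -rowE.
pose X : 'rV[C]_n := map_mx f x.
have Xreal : map_mx Num.conj X = X.
  by apply: realmxC; apply/mxOverP => i j; rewrite mxE.
rewrite invmx_unitary // in AE.
(* [Y] lists the coordinates of [x] in the eigenbasis. *)
pose Y := X *m P ^t*%sesqui.
have YE : Y ^t*%sesqui = P *m X^T.
  by rewrite /Y trmx_mul map_mxM trmxCK -map_trmx Xreal.
have YY i : Y 0 i * (Y ^t*%sesqui) i 0 = f (Re (`|Y 0 i| ^+ 2)).
  by rewrite !mxE -normCK; apply/esym/RRe_real; rewrite rpredX // normr_real.
exists (fun i => Re (`|Y 0 i| ^+ 2)); split => [i||].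
- by rewrite -lecR -YY !mxE -normCK exprn_ge0.
- apply: f_inj; rewrite sqnormE.
  have -> : f ((x *m x^T) 0 0) = (Y *m Y ^t*%sesqui) 0 0.
    rewrite YE mulmxA mulmxKtV //.
    by rewrite /X map_trmx -map_mxM [RHS]mxE.
  by rewrite mxE rmorph_sum; apply: eq_bigr => i _; rewrite /= -YY.
- apply: f_inj.
  have -> : f ((x *m S *m x^T) 0 0)
          = (Y *m diag_mx D *m Y ^t*%sesqui) 0 0.
    rewrite YE /Y !mulmxA -[X *m _ *m _]mulmxA -[X *m _ *m P]mulmxA -AE.
    by rewrite /X /A map_trmx -!map_mxM [RHS]mxE.
  rewrite mxE rmorph_sum; apply: eq_bigr => i _.
  by rewrite rmorphM /= -YY -dE mul_mx_diag mxE mulrCA mulrA.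
Qed.
End Spectral.

Lemma sqnorm_ge0 (R : realDomainType) n (x : 'rV[R]_n) : 0 <= sqnorm x.
Proof. by apply: sumr_ge0 => j _; rewrite sqr_ge0. Qed.

Lemma sqnorm_eq0 (R : realDomainType) n (x : 'rV[R]_n) :
  (sqnorm x == 0) = (x == 0).
Proof.
apply/eqP/eqP => [x0|->]; last first.
  by apply: big1 => j _; rewrite mxE expr0n.
apply/rowP => j; rewrite mxE; apply/eqP; rewrite -sqrf_eq0; apply/eqP.
by apply: (psumr_eq0P _ x0) => // i _; rewrite sqr_ge0.
Qed.

Lemma sqnorm0 (R : realDomainType) n : sqnorm (0 : 'rV[R]_n) = 0.
Proof. by apply/eqP; rewrite sqnorm_eq0. Qed.

(** * Extreme singular values *)

Lemma sqnorm_gram (R : realDomainType) n (A : 'M[R]_n) (x : 'rV[R]_n) :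
  sqnorm (x *m A^T) = (x *m (A^T *m A) *m x^T) 0 0.
Proof. by rewrite sqnormE trmx_mul trmxK !mulmxA. Qed.

Lemma gram_eigenvalueP (R : realFieldType) n (A : 'M[R]_n) a :
  eigenvalue (A^T *m A) a ->
  exists2 v : 'rV[R]_n, 0 < sqnorm v & sqnorm (v *m A^T) = a * sqnorm v.
Proof.
move=> /eigenvalueP[v vA v0]; exists v.
  by rewrite lt_neqAle eq_sym sqnorm_eq0 v0 sqnorm_ge0.
by rewrite sqnorm_gram vA -scalemxAl mxE -sqnormE.
Qed.

Lemma gram_eigenvalue_ge0 (R : realFieldType) n (A : 'M[R]_n) a :
  eigenvalue (A^T *m A) a -> 0 <= a.
Proof.
move=> /gram_eigenvalueP[v v0 vA].
by rewrite -(pmulr_lge0 _ v0) -vA sqnorm_ge0.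
Qed.

Lemma gram_spectral (R : rcfType) n (A : 'M[R]_n) :
  exists d : 'I_n -> R, (forall i, eigenvalue (A^T *m A) (d i)) /\
    forall x : 'rV[R]_n, exists w : 'I_n -> R,
      [/\ forall i, 0 <= w i, sqnorm x = \sum_i w i
        & sqnorm (x *m A^T) = \sum_i d i * w i].
Proof.
have [|d [eigd dP]] := @symmetric_spectral R n (A^T *m A).
  by rewrite trmx_mul trmxK.
by exists d; split=> // x; have [w] := dP x; rewrite -sqnorm_gram; exists w.
Qed.

Section SingularValues.
Variables (R : realType) (n : nat) (A : 'M[R]_n).

(** The spectral form gives [|v A^T|^2 <= (\sum_i d i) * |v|^2], and for an
    eigenvector [v] this bounds the eigenvalue. *)
Lemma singular_values_bounded :
  has_lbound (singular_values A) /\ has_ubound (singular_values A).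
Proof.
have [d [eigd dP]] := gram_spectral A; split.
  by exists 0 => _ [a _ <-]; rewrite sqrtr_ge0.
exists (Num.sqrt (\sum_i d i)) => _ [a eiga <-]; apply: ler_wsqrtr.
have [v v0 vA] := gram_eigenvalueP eiga.
have [w [w0 vw vAw]] := dP v.
rewrite -(ler_pM2r v0) -vA vAw vw mulr_suml; apply: ler_sum => i _.
rewrite ler_wpM2l ?(gram_eigenvalue_ge0 (eigd i)) //.
by rewrite (bigD1 i) //= lerDl sumr_ge0.
Qed.

Lemma singular_values_neq0 : (0 < n)%N -> (singular_values A !=set0)%classic.
Proof.
have [d [eigd _]] := gram_spectral A => n0.
exists (Num.sqrt (d (Ordinal n0))).
by exists (d (Ordinal n0)) => //; exact: eigd.
Qed.

Lemma sigma_min_ge0 : 0 <= sigma_min A.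
Proof.
have [/set0P ne|/negP] := boolP (singular_values A != set0)%classic.
  by apply: lb_le_inf ne _ => _ [a _ <-]; rewrite sqrtr_ge0.
by move=> /negP; rewrite negbK /sigma_min => /eqP ->; rewrite inf0.
Qed.

Lemma sigma_max_ge0 : 0 <= sigma_max A.
Proof.
have [/set0P [s As]|] := boolP (singular_values A != set0)%classic.
  have [a _ sE] := As; apply: (@le_trans _ _ s); first by rewrite -sE sqrtr_ge0.
  apply: sup_upper_bound => //.
  by split; [exists s | case: singular_values_bounded].
by rewrite negbK /sigma_max => /eqP ->; rewrite sup0.
Qed.

Lemma sigma_min_le a : eigenvalue (A^T *m A) a -> sigma_min A ^+ 2 <= a.
Proof.
move=> eiga; rewrite -[leRHS](sqr_sqrtr (gram_eigenvalue_ge0 eiga)).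
rewrite ler_pXn2r ?nnegrE ?sqrtr_ge0 ?sigma_min_ge0 //.
by apply: ge_inf; [case: singular_values_bounded | exists a].
Qed.

Lemma sigma_max_ge a : eigenvalue (A^T *m A) a -> a <= sigma_max A ^+ 2.
Proof.
move=> eiga; rewrite -[leLHS](sqr_sqrtr (gram_eigenvalue_ge0 eiga)).
rewrite ler_pXn2r ?nnegrE ?sqrtr_ge0 ?sigma_max_ge0 //.
apply: sup_upper_bound; last by exists a.
by split; [exists (Num.sqrt a); exists a | case: singular_values_bounded].
Qed.

(** In the spectral form of [|x A^T|^2], every eigenvalue is at least
    [sigma_min A ^+ 2] and at most [sigma_max A ^+ 2]. *)
Lemma sigma_min_sqnorm (x : 'rV[R]_n) :
  sigma_min A ^+ 2 * sqnorm x <= sqnorm (x *m A^T).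
Proof.
have [d [eigd /(_ x)[w [w0 -> ->]]]] := gram_spectral A.
rewrite mulr_sumr; apply: ler_sum => i _.
by rewrite ler_wpM2r ?sigma_min_le.
Qed.

Lemma sigma_max_sqnorm (x : 'rV[R]_n) :
  sqnorm (x *m A^T) <= sigma_max A ^+ 2 * sqnorm x.
Proof.
have [d [eigd /(_ x)[w [w0 -> ->]]]] := gram_spectral A.
rewrite mulr_sumr; apply: ler_sum => i _.
by rewrite ler_wpM2r ?sigma_max_ge.
Qed.

(** An eigenvector of the Gram matrix, put in place of [x], shows that its
    eigenvalue lies between [lo] and [hi].  The matrix must be nonempty so that
    there is an eigenvalue: [inf] and [sup] of the empty set are default
    values. *)
Lemma sigma_bounds (lo hi : R) : (0 < n)%N -> 0 <= lo ->
  (forall x : 'rV[R]_n, lo * sqnorm x <= sqnorm (x *m A^T)) ->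
  (forall x : 'rV[R]_n, sqnorm (x *m A^T) <= hi * sqnorm x) ->
  [/\ lo <= sigma_min A ^+ 2, sigma_min A ^+ 2 <= sigma_max A ^+ 2
    & sigma_max A ^+ 2 <= hi].
Proof.
move=> n0 lo0 loP hiP; have ne := singular_values_neq0 n0.
have eig_in a : eigenvalue (A^T *m A) a -> lo <= a <= hi.
  move=> /gram_eigenvalueP[v v0 vA].
  by rewrite -(ler_pM2r v0) -vA loP /= -(ler_pM2r v0) -vA hiP.
have [_ [a eiga _]] := ne.
have hi0 : 0 <= hi.
  by have /andP[loa] := eig_in _ eiga; apply: le_trans; exact: le_trans loa.
split.
- rewrite -(sqr_sqrtr lo0) ler_pXn2r ?nnegrE ?sqrtr_ge0 ?sigma_min_ge0 //.
  apply: lb_le_inf ne _ => _ [b eigb <-]; apply: ler_wsqrtr.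
  by case/andP: (eig_in _ eigb).
- exact: le_trans (sigma_min_le eiga) (sigma_max_ge eiga).
- rewrite -(sqr_sqrtr hi0) ler_pXn2r ?nnegrE ?sqrtr_ge0 ?sigma_max_ge0 //.
  apply: ge_sup ne _ => _ [b eigb <-]; apply: ler_wsqrtr.
  by case/andP: (eig_in _ eigb).
Qed.

End SingularValues.

Lemma sigma0 (R : realType) n : (0 < n)%N ->
  sigma_min (0 : 'M[R]_n) = 0 /\ sigma_max (0 : 'M[R]_n) = 0.
Proof.
move=> n0.
have [||||_ min_max max0] := @sigma_bounds R n 0 0 0 => // [x|x|].
- by rewrite mul0r sqnorm_ge0.
- by rewrite mul0r trmx0 mulmx0 sqnorm0.
have max20 : sigma_max (0 : 'M[R]_n) ^+ 2 = 0.
  by apply/eqP; rewrite eq_le max0 sqr_ge0.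
have min20 : sigma_min (0 : 'M[R]_n) ^+ 2 = 0.
  by apply/eqP; rewrite eq_le sqr_ge0 andbT -max20.
by split; apply/eqP; rewrite -sqrf_eq0; apply/eqP.
Qed.

(** * Block bidiagonal matrices *)

(** The quantity on the left is twice the absolute inner product of [u] and [v].
    For [s > 0] the bound expands [|s v + u|^2 >= 0] and [|- s v + u|^2 >= 0]
    and divides by [s]; for [s = 0] the vector [u] vanishes. *)
Lemma sqnormD_dist (R : realFieldType) n (u v : 'rV[R]_n) (s b : R) :
  0 <= s -> sqnorm u <= s ^+ 2 * b ->
  `|sqnorm (v + u) - (sqnorm v + sqnorm u)| <= s * (sqnorm v + b).
Proof.
move=> s0 ub; have u0 := sqnorm_ge0 u.
have [s_eq0|s_neq0] := eqVneq s 0.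
  have /eqP : sqnorm u = 0.
    by apply/eqP; rewrite eq_le u0 (le_trans ub) // s_eq0 expr0n mul0r.
  rewrite sqnorm_eq0 => /eqP ->.
  by rewrite sqnorm0 !addr0 subrr normr0 s_eq0 mul0r.
have sp : 0 < s by rewrite lt_neqAle eq_sym s_neq0.
pose c := \sum_j 2 * (v 0 j * u 0 j).
have expand (t : R) :
    sqnorm (t *: v + u) = t ^+ 2 * sqnorm v + t * c + sqnorm u.
  rewrite /sqnorm !mulr_sumr -!big_split; apply: eq_bigr => j _ /=.
  by rewrite !mxE; ring.
have -> : sqnorm (v + u) - (sqnorm v + sqnorm u) = c.
  by rewrite -[v in v + u]scale1r expand; ring.
have := sqnorm_ge0 (s *: v + u); have := sqnorm_ge0 (- s *: v + u).
rewrite !expand => ge0m ge0p.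
rewrite -(ler_pM2l sp) -[X in X * `|_|](ger0_norm s0) -normrM ler_norml.
by apply/andP; split; lra.
Qed.

(** Summation by shift of the index: the terms lost and gained at the two ends
    are zero. *)
Lemma sum_shift (R : pzRingType) (N : nat) (a c f : nat -> R) :
  f 0%N = 0 -> c N.+1 = 0 ->
  \sum_(1 <= k < N.+1) (a k + c k.+1) * f k
  = \sum_(1 <= k < N.+1) (a k * f k + c k * f k.-1).
Proof.
move=> f0 cN; under eq_bigr do rewrite mulrDl.
rewrite !big_split; congr (_ + _) => /=.
case: N cN => [|M] cM; first by rewrite !big_geq.
rewrite big_nat_recr //= cM mul0r addr0.
rewrite [RHS]big_add1 [RHS]big_nat_recl //= f0 mulr0 add0r.
by rewrite big_add1.
Qed.

Section Blocks.
Variables (R : realType) (n N : nat).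
Implicit Type x : 'rV[R]_(\sum_(i < N) n).

(** Blocks are numbered from 1, and all other indices give 0: block 0 is the
    predecessor of the first block. *)
Definition block_at x (k : nat) : 'rV[R]_n :=
  if k is k'.+1 then oapp (fun i : 'I_N => submxrow x i) 0 (insub k') else 0.
Arguments block_at : simpl never.

Lemma block_at0 x : block_at x 0 = 0.
Proof. by []. Qed.

Lemma block_atS x (i : 'I_N) : block_at x i.+1 = submxrow x i.
Proof. by rewrite /block_at valK. Qed.

Lemma sqnorm_blocks x : sqnorm x = \sum_(1 <= k < N.+1) sqnorm (block_at x k).
Proof.
rewrite big_add1 big_mkord -[in LHS](submxrowK x) sqnormE tr_mxrow.
rewrite mul_mxrow_mxcol summxE; apply: eq_bigr => i _.
by rewrite block_atS sqnormE.
Qed.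

Lemma bidiag_block (g : nat -> 'M[R]_n) x k : (0 < k <= N)%N ->
  block_at (x *m (bidiag_mx N g)^T) k
  = block_at x k + block_at x k.-1 *m (g k)^T.
Proof.
case: k => [//|k] /= kN; pose i : 'I_N := Ordinal kN.
rewrite -[k.+1]/(i.+1) !block_atS.
rewrite -[in LHS](submxrowK x) /bidiag_mx tr_mxblock mul_mxrow_mxblock mxrowK.
rewrite (bigD1 i) //= eqxx trmx1 mulmx1; congr (_ + _).
case: k kN @i => [|k] kN i.
  rewrite block_at0 mul0mx big1 // => j ji.
  by rewrite eq_sym (negPf ji) /= trmx0 mulmx0.
pose j : 'I_N := Ordinal (ltnW kN); rewrite -[k.+1]/(j.+1) block_atS.
rewrite (bigD1 j) /=; last by rewrite -val_eqE /= ltn_eqF.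
rewrite -val_eqE /= gtn_eqF // eqxx big1 ?addr0 // => l /andP[li lj].
rewrite eq_sym (negPf li) eqSS; case: eqP => [kl|_]; last first.
  by rewrite trmx0 mulmx0.
by case/eqP: lj; apply: val_inj.
Qed.

Lemma sum_blocks_shift x (a c : nat -> R) : c N.+1 = 0 ->
  \sum_(1 <= k < N.+1) (a k + c k.+1) * sqnorm (block_at x k)
  = \sum_(1 <= k < N.+1)
      (a k * sqnorm (block_at x k) + c k * sqnorm (block_at x k.-1)).
Proof.
exact: (@sum_shift R N a c (fun k => sqnorm (block_at x k)) (sqnorm0 R n)).
Qed.

End Blocks.

Theorem mainTheorem2 (R : realType) (n N : nat) (hn : (1 <= n)%N)
    (hN : (1 <= N)%N) (g : nat -> 'M[R]_n)
    (hg1 : g 1%N = 0) (hgN : g N.+1 = 0) :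
  [/\ Num.max 0 (min_upto N (fun k =>
        1 + sigma_min (g k.+1) ^+ 2 - sigma_max (g k) - sigma_max (g k.+1)))
      <= sigma_min (bidiag_mx N g) ^+ 2,
      sigma_min (bidiag_mx N g) ^+ 2 <= sigma_max (bidiag_mx N g) ^+ 2
    & sigma_max (bidiag_mx N g) ^+ 2
      <= max_upto N (fun k =>
        1 + sigma_max (g k.+1) ^+ 2 + sigma_max (g k) + sigma_max (g k.+1))].
Proof.
have [min0 max0] := sigma0 R hn.
have pos x k : 0 <= sqnorm (@block_at R n N x k) := sqnorm_ge0 _.
apply: sigma_bounds.
- by rewrite sum_nat_const card_ord muln_gt0 hN.
- by rewrite le_max lexx.
- (* When the minimum is nonpositive the constant to be tested is 0. *)
  move=> x; set F := fun k => 1 + sigma_min _ ^+ 2 - _ - _.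
  have [_|_] := leP (min_upto N F) 0; first by rewrite mul0r sqnorm_ge0.
  rewrite !sqnorm_blocks mulr_sumr.
  apply: (@le_trans _ _ (\sum_(1 <= k < N.+1) F k * sqnorm (block_at x k))).
    apply: ler_sum_nat => k kN; rewrite ler_wpM2r //.
    by apply: ge_bigmin_seq; rewrite // mem_index_iota.
  pose a k := 1 - sigma_max (g k).
  pose c k := sigma_min (g k) ^+ 2 - sigma_max (g k).
  rewrite (eq_bigr (fun k => (a k + c k.+1) * sqnorm (block_at x k))) /=;
    last by move=> k _; rewrite /F /a /c; ring.
  rewrite sum_blocks_shift; last by rewrite /c hgN min0 max0 expr0n subrr.
  apply: ler_sum_nat => k kN; rewrite bidiag_block // /a /c.
  set v := block_at x k; set u := block_at x k.-1.
  have := sqnormD_dist v (sigma_max_ge0 (g k)) (sigma_max_sqnorm (g k) u).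
  have := sigma_min_sqnorm (g k) u.
  by rewrite ler_norml => ? /andP[? ?]; lra.
- move=> x; set G := fun k : nat => 1 + sigma_max _ ^+ 2 + _ + _.
  rewrite !sqnorm_blocks mulr_sumr.
  apply: (@le_trans _ _ (\sum_(1 <= k < N.+1) G k * sqnorm (block_at x k)));
    last first.
    apply: ler_sum_nat => k kN; rewrite ler_wpM2r //.
    by apply: le_bigmax_seq; rewrite // mem_index_iota.
  pose a k := 1 + sigma_max (g k).
  pose c k := sigma_max (g k) ^+ 2 + sigma_max (g k).
  rewrite [leRHS](eq_bigr (fun k => (a k + c k.+1) * sqnorm (block_at x k)));
    last by move=> k _; rewrite /G /a /c; ring.
  rewrite sum_blocks_shift; last by rewrite /c hgN max0 expr0n addr0.
  apply: ler_sum_nat => k kN; rewrite bidiag_block // /a /c.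
  set v := block_at x k; set u := block_at x k.-1.
  have := sqnormD_dist v (sigma_max_ge0 (g k)) (sigma_max_sqnorm (g k) u).
  have := sigma_max_sqnorm (g k) u.
  by rewrite ler_norml => ? /andP[? ?]; lra.
Qed.
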